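(* Let $q$ be a power of an odd prime, let $\mathcal{Q}$ be the set of nonzero squares and $\mathcal{N}$ the set of nonsquares in $\mathrm{GF}(q)$. Let $\tau\in\mathrm{GF}(q)^*$, $B_\tau=\mathcal{Q}\cap(\mathcal{Q}+\tau)$ with $\mathcal{Q}+\tau=\{x+\tau:x\in\mathcal{Q}\}$, $\mathcal{P}=\mathrm{GF}(q)$, and $\mathcal{B}=\{g(B_\tau): g\in\mathrm{GA}_1(q)\}$, where $\mathrm{GA}_1(q)=\{x\mapsto ax+b:a\in\mathrm{GF}(q)^*,b\in\mathrm{GF}(q)\}$. Then $(\mathcal{P},\mathcal{B})$ is a $2$-$(q,k,\lambda)$ design, where $$k=\begin{cases}\frac{q-3}{4} & \text{if } q\equiv 3\pmod 4,\\ \frac{q-5}{4} & \text{if } q\equiv 1\pmod 4 \text{ and } \tau\in\mathcal{Q},\\ \frac{q-1}{4} & \text{if } q\equiv 1\pmod 4\text{ and }\tau\in\mathcal{N},\end{cases}\qquad \lambda=\begin{cases}k(k-1) & \text{if } q\equiv 3\pmod 4,\\ \frac{k(k-1)}{2} & \text{if } q\equiv 1\pmod 4.\end{cases}$$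
   Context: A $t$-$(v,k,\lambda)$ design is a pair $(\mathcal{P},\mathcal{B})$ with $|\mathcal{P}|=v$ and $\mathcal{B}$ a set of $k$-subsets of $\mathcal{P}$ (blocks) such that every $t$-subset of $\mathcal{P}$ lies in exactly $\lambda$ blocks.
   Formalization: The case q = 11 is excluded: there B_τ has k = 2 points, the blocks are all 55 pairs, and every pair lies in exactly 1 block, whereas the formula gives λ = k(k-1) = 2. *)

(* Defs.v *)
From HB Require Import structures.
From mathcomp Require Import all_boot all_order all_algebra all_field.

Set Implicit Arguments.
Unset Strict Implicit.
Unset Printing Implicit Defensive.

Import GRing.Theory.
Local Open Scope ring_scope.

(* The point set is all of [P]. The blocks form a set, so equal blocks are
   counted once. *)
Definition is_design (t v k lambda : nat) (P : finType) (B : {set {set P}}) :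
    Prop :=
  [/\ #|P| = v,
      forall b : {set P}, b \in B -> #|b| = k
    & forall S : {set P}, #|S| = t ->
        #|[set b in B | S \subset b]| = lambda].

Definition nzsquares (F : finFieldType) : {set F} :=
  [set x : F | (x != 0) && [exists y : F, x == y ^+ 2]].

Definition nonsquares (F : finFieldType) : {set F} :=
  [set x : F | ~~ [exists y : F, x == y ^+ 2]].

Definition GA1 (F : finFieldType) : {set {ffun F -> F}} :=
  [set [ffun x : F => a * x + b] | a in [set a : F | a != 0],
                                   b in [set: F]].

Definition base_block (F : finFieldType) (tau : F) : {set F} :=
  nzsquares F :&: [set x + tau | x in nzsquares F].

Definition GA1_blocks (F : finFieldType) (B : {set F}) : {set {set F}} :=
  [set [set g x | x in B] | g : {ffun F -> F} in GA1 F].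

(* Main.v *)
(* By double counting, every pair of points lies in [k * (k - 1) / s] blocks,
   where [s] is the order of the stabiliser of the base block B in the affine
   group. Counting points of the hyperbola [u ^+ 2 - v ^+ 2 = tau], parametrised
   by [u + v], gives [k]; weighting the same count by powers of
   [2 * u ^+ 2 / tau - 1] gives the power sums of B (after an affine change of
   coordinate) of every order [j < (q - 1) / 2], in closed form. An affine map
   that fixes B must preserve these power sums, and orders at most 5 (or 10 in
   characteristic 3) leave only the identity, together with the reflection
   [x |-> tau - x] when [q = 1 %[mod 4]]. *)
Require Import Defs.
From HB Require Import structures.
From mathcomp Require Import all_boot all_order all_algebra all_field.
From mathcomp Require Import all_solvable ring zify.

Set Implicit Arguments.
Unset Strict Implicit.
Unset Printing Implicit Defensive.

Import GRing.Theory.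
Local Open Scope ring_scope.

(** * Square roots and sums over the hyperbola *)

Definition nsqrt (F : finFieldType) (z : F) : nat :=
  #|[set u : F | u ^+ 2 == z]|.

Lemma nsqrt0 (F : finFieldType) : nsqrt (0 : F) = 1%N.
Proof.
rewrite /nsqrt -(cards1 (0 : F)); congr #|pred_of_set _|.
by apply/setP=> u; rewrite !inE expf_eq0.
Qed.

Lemma nsqrt_nzsquare (F : finFieldType) (two_neq0 : 2%:R != 0 :> F) (z : F) :
  z != 0 -> nsqrt z = ((z \in nzsquares F) * 2)%N.
Proof.
move=> z_neq0; rewrite inE z_neq0 /=.
case: existsP => [[u /eqP z_u]|no_root] /=; last first.
  apply/eqP; rewrite mul0n cards_eq0; apply/eqP/setP=> u; rewrite !inE.
  by apply/negP=> /eqP z_u; apply: no_root; exists u; rewrite z_u.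
have u_neq0 : u != 0 by apply: contraNneq z_neq0 => u0; rewrite z_u u0 expr0n.
have uN : u != - u.
  by rewrite -subr_eq0 opprK -mulr2n -mulr_natl mulf_neq0.
rewrite /nsqrt mul1n -[RHS]/(true.+1) -uN -cards2; congr #|pred_of_set _|.
by apply/setP=> v; rewrite !inE z_u eqf_sqr.
Qed.

Lemma in_base_block (F : finFieldType) (tau y : F) :
  (y \in base_block tau) = (y \in nzsquares F) && (y - tau \in nzsquares F).
Proof.
rewrite in_setI; congr (_ && _); apply/imsetP/idP=> [[x x_sq ->]|y_sq].
  by rewrite addrK.
by exists (y - tau) => //; rewrite subrK.
Qed.

(* Both sides sum [h (u ^+ 2)] over the points of the hyperbola
   [u ^+ 2 - v ^+ 2 = tau], which is parametrised by [t = u + v]. *)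
Lemma sum_base_block (F : finFieldType) (V : nmodType) (h : F -> V) (tau : F) :
    2%:R != 0 :> F -> tau != 0 ->
  (\sum_(y in base_block tau) h y) *+ 4 + h 0 *+ nsqrt (- tau)
      + h tau *+ nsqrt tau
  = \sum_(t : F | t != 0) h (((t + tau / t) / 2%:R) ^+ 2).
Proof.
move=> two_neq0 tau_neq0.
transitivity (\sum_(p : F * F | p.1 ^+ 2 - p.2 ^+ 2 == tau) h (p.1 ^+ 2));
    last first.
  rewrite (reindex_onto
    (fun t : F => ((t + tau / t) / 2%:R, (t - tau / t) / 2%:R))
    (fun p : F * F => p.1 + p.2)) => [|[u v] /= /eqP uv_tau]; last first.
    have uv_neq0 : u + v != 0.
      apply: contraNneq tau_neq0 => uv0; rewrite -uv_tau subr_sqr uv0 mulr0 //.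
    by congr (_, _); rewrite -uv_tau; field; apply/andP.
  (* Since [tau / 0 = 0], the parameter [t = 0] would give the point [(0, 0)], which is off the
     hyperbola. *)
  apply: eq_bigl => t /=; case: (eqVneq t 0) => [->|t_neq0].
    rewrite invr0 mulr0 addr0 subr0 mul0r expr0n subr0.
    by rewrite eq_sym (negPf tau_neq0).
  by apply/andP; split; apply/eqP; field; rewrite ?two_neq0 ?t_neq0.
transitivity (\sum_(u : F) h (u ^+ 2) *+ nsqrt (u ^+ 2 - tau)); last first.
  rewrite -(pair_big_dep predT (fun u v => u ^+ 2 - v ^+ 2 == tau)
     (fun u _ => h (u ^+ 2))) /=; apply: eq_bigr => u _.
  rewrite -sumr_const; apply: eq_bigl => v.
  by rewrite inE eq_sym [LHS]subr_eq [RHS]subr_eq addrC.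
transitivity (\sum_(y : F) h y *+ (nsqrt (y - tau) * nsqrt y)); last first.
  rewrite [RHS](partition_big (fun u : F => u ^+ 2) predT) //=.
  apply: eq_bigr => y _; rewrite mulrnA.
  rewrite (eq_bigr (fun=> h y *+ nsqrt (y - tau))) => [|u /eqP-> //].
  by rewrite -sumr_const; apply: eq_bigl => u; rewrite inE.
(* At [y = 0] and [y = tau] one factor is the single root of [0]. Any other [y] has two roots on
   each side, hence weight 4, exactly when it lies in the base block. *)
rewrite [RHS](bigD1 0) //= [X in _ = _ + X](bigD1 tau) //=.
rewrite sub0r subrr nsqrt0 muln1 mul1n -addrA addrC addrA; congr (_ + _).
rewrite -sumrMnl (big_mkcond _ (fun y => _ *+ (_ * _))) /= big_mkcond /=.
apply: eq_bigr => y _; rewrite in_base_block.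
have [->|y_neq0] := eqVneq y 0; first by rewrite inE eqxx.
have [->|y_tau] := eqVneq y tau.
  by rewrite subrr ![_ \in _]inE eqxx andbF.
rewrite !nsqrt_nzsquare ?subr_eq0 //=.
by case: (y \in _); case: (_ \in _); rewrite ?muln0 ?mulr0n.
Qed.

(** * Power sums of the base block *)

Lemma expf_card_pred (F : finFieldType) (x : F) :
  x != 0 -> x ^+ #|F|.-1 = 1.
Proof.
move=> x_neq0; apply: (mulfI x_neq0).
by rewrite mulr1 -exprS prednK ?expf_card // (cardD1 x).
Qed.

Lemma ex_prim_root_card (F : finFieldType) :
  exists g : F, #|F|.-1.-primitive_root g.
Proof.
have card_gt1 := finNzRing_gt1 F.
have card_units : #|[set~ (0 : F)]| = #|F|.-1 by rewrite cardsC1.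
have: has #|F|.-1.-primitive_root (enum [set~ (0 : F)]).
  apply: has_prim_root; rewrite ?enum_uniq -?cardE ?card_units //.
    by rewrite -subn1 subn_gt0.
  apply/allP=> x; rewrite mem_enum !inE => x_neq0.
  by rewrite unity_rootE expf_card_pred.
by case/hasP=> g _ g_prim; exists g.
Qed.

(** Replacing [x] by [x + 1] permutes the terms of the sum of all elements, yet adds [#|F|] to
    it. *)
Lemma card_natr_eq0 (F : finFieldType) : #|F|%:R = 0 :> F.
Proof.
apply: (addrI (\sum_(x : F) x)).
rewrite -sum1_card natr_sum -big_split addr0 [RHS](reindex_inj (addIr 1)).
by [].
Qed.

(** The constant term of the Laurent polynomial [(X + 1 / X) ^ j]. *)
Definition central_binomial (j : nat) : nat :=
  if odd j then 0%N else 'C(j, j./2).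

(** Character orthogonality. For [i = j] every term is 1. Otherwise the substitution [t |-> g * t],
    with [g] a primitive root, multiplies the sum by [g ^ (2i - 2j)], which is not 1 because both
    exponents lie below [#|F| - 1]. *)
Lemma sum_torus_monomial (F : finFieldType) (tau : F) (i j : nat) :
    tau != 0 -> (2 * i < #|F|.-1)%N -> (2 * j < #|F|.-1)%N ->
  \sum_(t : F | t != 0) (t ^+ 2 / tau) ^+ i * (tau / t ^+ 2) ^+ j
  = - (i == j)%:R.
Proof.
move=> tau_neq0 i_lt j_lt.
have [<-|i_neq_j] := eqVneq i j.
  rewrite (eq_bigr (fun=> 1)) => [|t t_neq0]; last first.
    rewrite -exprMn (_ : _ * _ = 1) ?expr1n //.
    by field; rewrite t_neq0.
  rewrite sumr_const (eq_card (B := [set~ (0 : F)])); last first.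
    by move=> x; rewrite !inE.
  by rewrite cardsC1 -subn1 natrB ?card_natr_eq0 ?sub0r // ltnW ?finNzRing_gt1.
have [g g_prim] := ex_prim_root_card F.
have g_neq0 : g != 0.
  by rewrite (prim_root_eq0 g_prim) -lt0n -subn1 subn_gt0 finNzRing_gt1.
rewrite oppr0; set S := (S in S = 0).
have S_scale : S = (g ^+ 2) ^+ i * (g ^+ 2) ^- j * S.
  rewrite {1}/S (reindex_inj (mulfI g_neq0)) big_distrr.
  apply: eq_big => [t|t]; first by rewrite mulf_eq0 (negPf g_neq0).
  rewrite mulf_eq0 (negPf g_neq0) /= => t_neq0.
  rewrite mulrACA -(exprVn (g ^+ 2)) -2!exprMn.
  by congr (_ ^+ _ * _ ^+ _); field; rewrite ?g_neq0 ?t_neq0.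
apply/eqP; have := i_neq_j; apply: contraNT => S_neq0.
have /eqP : g ^+ (2 * i) = g ^+ (2 * j).
  rewrite !exprM; apply: (mulIf (x := (g ^+ 2) ^- j)).
    by rewrite invr_eq0 !expf_neq0.
  apply: (mulIf S_neq0); rewrite -S_scale divff ?mul1r //.
  by rewrite !expf_neq0.
by rewrite (eq_prim_root_expr g_prim) !modn_small // eqn_mul2l.
Qed.

Lemma sum_torus (F : finFieldType) (tau : F) (j : nat) :
    tau != 0 -> (2 * j < #|F|.-1)%N ->
  \sum_(t : F | t != 0) (t ^+ 2 / tau + tau / t ^+ 2) ^+ j
  = - (central_binomial j)%:R.
Proof.
move=> tau_neq0 j_lt.
under eq_bigr => t _ do rewrite exprDn.
rewrite exchange_big /=.
have term (i : 'I_j.+1) :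
    \sum_(t : F | t != 0)
        (t ^+ 2 / tau) ^+ (j - i) * (tau / t ^+ 2) ^+ i *+ 'C(j, i)
    = - ((j == i.*2) * 'C(j, i))%:R.
  have i_le := ltn_ord i; rewrite sumrMnl sum_torus_monomial //; try lia.
  rewrite mulNrn natrM mulr_natr; congr (- (_%:R *+ _)).
  by apply/eqP; lia.
rewrite (eq_bigr _ (fun i _ => term i)) sumrN -natr_sum; congr (- _%:R).
rewrite /central_binomial; have [j_odd|j_even] := ifPn.
  rewrite big1 // => i _; case: eqP => // j_i.
  by rewrite j_i odd_double in j_odd.
have half_lt : (j./2 < j.+1)%N by lia.
rewrite (bigD1 (Ordinal half_lt)) //= big1 => [|i i_half].
  by rewrite addn0; case: eqP => [|j_half]; [rewrite mul1n | lia].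
by case: eqP => // j_i; case/eqP: i_half; apply: val_inj => /=; lia.
Qed.

(** At [y = ((t + tau / t) / 2) ^ 2] the coordinate [2 * y / tau - 1] is half of
    [t ^ 2 / tau + tau / t ^ 2]. The exceptional points [y = 0] and [y = tau] have coordinates [-1]
    and [1]. *)
Lemma power_sum_base_block (F : finFieldType) (tau : F) (j : nat) :
    2%:R != 0 :> F -> tau != 0 -> (2 * j < #|F|.-1)%N ->
  (\sum_(y in base_block tau) (2%:R * y / tau - 1) ^+ j) * 4%:R
  = - ((central_binomial j)%:R / 2%:R ^+ j
       + (-1) ^+ j * (nsqrt (- tau))%:R + (nsqrt tau)%:R).
Proof.
move=> two_neq0 tau_neq0 j_lt.
have := sum_base_block (fun y => (2%:R * y / tau - 1) ^+ j) two_neq0 tau_neq0.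
rewrite [X in _ = X -> _](eq_bigr (fun t =>
    (t ^+ 2 / tau + tau / t ^+ 2) ^+ j / 2%:R ^+ j));
    last first.
  by move=> t t_neq0; rewrite -expr_div_n; congr (_ ^+ _); field; apply/and3P.
rewrite -big_distrl /= sum_torus // mulr0 mul0r sub0r mulfK //.
rewrite (_ : 2%:R - 1 = 1) ?expr1n; last by ring.
rewrite mulr_natr -[_ *+ nsqrt (- _)]mulr_natr -addrA => /(canRL (addrK _)) ->.
by ring.
Qed.

(** * Affine images and double counting *)

Definition affine (F : finFieldType) (g : F * F) (x : F) : F := g.1 * x + g.2.

Definition affine_stab (F : finFieldType) (B : {set F}) : {set F * F} :=
  [set g : F * F | (g.1 != 0) && (affine g @: B == B)].

Lemma affine_inj (F : finFieldType) (g : F * F) :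
  g.1 != 0 -> injective (affine g).
Proof. by move=> g_neq0 x y /addIr /(mulfI g_neq0). Qed.

Lemma affine_comp_imset (F : finFieldType) (g h : F * F) (B : {set F}) :
  affine g @: (affine h @: B) = affine (g.1 * h.1, g.1 * h.2 + g.2) @: B.
Proof.
rewrite -imset_comp; apply: eq_imset => x /=.
by rewrite /affine /= mulrDr mulrA addrA.
Qed.

Lemma affine_imset_inj (F : finFieldType) (g : F * F) :
  g.1 != 0 -> injective (fun B : {set F} => affine g @: B).
Proof. by move=> g_neq0; apply/imset_inj/affine_inj. Qed.

Lemma GA1_blocksE (F : finFieldType) (B : {set F}) :
  GA1_blocks B = [set affine g @: B | g in [set g : F * F | g.1 != 0]].
Proof.
apply/setP=> C; apply/imsetP/imsetP => [[f]|[[a b]]].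
  case/imset2P=> a b; rewrite inE => a_neq0 _ -> ->.
  exists (a, b); first by rewrite inE.
  by apply: eq_imset => x; rewrite ffunE.
rewrite inE => a_neq0 ->; exists [ffun x : F => a * x + b].
  by apply/imset2P; exists a b; rewrite ?inE.
by apply: eq_imset => x; rewrite ffunE.
Qed.

Lemma card_GA1_block (F : finFieldType) (B C : {set F}) :
  C \in GA1_blocks B -> #|C| = #|B|.
Proof.
rewrite GA1_blocksE => /imsetP[g]; rewrite inE => g_neq0 ->.
exact/card_imset/affine_inj.
Qed.

(** The maps with the same image of [B] as [g0] form the coset of the stabiliser obtained by
    composing with [g0]. *)
Lemma card_affine_fiber (F : finFieldType) (B : {set F}) (g0 : F * F) :
    g0.1 != 0 ->
  #|[set g : F * F | (g.1 != 0) && (affine g @: B == affine g0 @: B)]|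
  = #|affine_stab B|.
Proof.
move=> g0_neq0.
have comp_inj : injective
    (fun g : F * F => (g0.1 * g.1, g0.1 * g.2 + g0.2)).
  by move=> [a b] [c d] [/(mulfI g0_neq0)-> /addIr/(mulfI g0_neq0)->].
rewrite -[RHS](card_imset _ comp_inj); apply: eq_card => g.
rewrite inE; apply/andP/imsetP => [[g_neq0 /eqP gB]|[h]].
  exists (g.1 / g0.1, (g.2 - g0.2) / g0.1); last first.
    by case: g {g_neq0 gB} => a b /=; congr (_, _); field.
  rewrite inE mulf_neq0 ?invr_eq0 //=; apply/eqP.
  apply: (affine_imset_inj g0_neq0); rewrite affine_comp_imset /= -gB.
  by congr (imset (affine _) _); case: g {g_neq0 gB} => a b /=;
    congr (_, _); field.
rewrite inE => /andP[h_neq0 /eqP hB] -> /=.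
by rewrite mulf_neq0 // -affine_comp_imset hB.
Qed.

Lemma card_ordered_pairs (T : finType) (B : {set T}) :
  #|[set x : T * T | [&& x.1 \in B, x.2 \in B & x.1 != x.2]]|
  = (#|B| * (#|B| - 1))%N.
Proof.
rewrite -sum1_card -sum_nat_const.
rewrite (eq_bigl (fun x : T * T => (x.1 \in B) && (x.2 \in B :\ x.1)));
  last by move=> x; rewrite !inE [_ && (x.1 != _)]andbC eq_sym.
rewrite -(pair_big_dep (mem B) (fun x y => y \in B :\ x) (fun _ _ => 1%N)) /=.
apply: eq_bigr => x xB; rewrite sum1_card.
by rewrite (cardsD1 x B) xB add1n subn1.
Qed.

(** The affine group is sharply 2-transitive: [g] is determined by the ordered pair of preimages of
    [s] and [t], and [f] recovers [g] from that pair. *)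
Lemma card_affine_cover_pair (F : finFieldType) (B : {set F}) (s t : F) :
    s != t ->
  #|[set g : F * F | (g.1 != 0) && ([set s; t] \subset affine g @: B)]|
  = (#|B| * (#|B| - 1))%N.
Proof.
move=> s_neq_t; have st_neq0 : s - t != 0 by rewrite subr_eq0.
rewrite -card_ordered_pairs.
pose f (x : F * F) : F * F :=
  ((s - t) / (x.1 - x.2), s - (s - t) / (x.1 - x.2) * x.1).
have fP (x : F * F) : x.1 != x.2 ->
    [/\ (f x).1 != 0, affine (f x) x.1 = s & affine (f x) x.2 = t].
  rewrite -subr_eq0 => x_neq; split; rewrite /affine /=.
  - by rewrite mulf_neq0 ?invr_eq0.
  - by field.
  - by field.
rewrite -[RHS](card_in_imset (f := f)) => [|x y]; last first.
  rewrite !inE => /and3P[_ _ /fP[fx_neq0 fx1 fx2]] /and3P[_ _ /fP[_ fy1 fy2]].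
  move=> fxy; rewrite -fxy in fy1 fy2.
  have := affine_inj fx_neq0 (etrans fx1 (esym fy1)).
  have := affine_inj fx_neq0 (etrans fx2 (esym fy2)).
  by case: x y {fxy fx_neq0 fx1 fx2 fy1 fy2} => [? ?] [? ?] /= -> ->.
apply: eq_card => g; rewrite inE; apply/andP/imsetP => [[g_neq0]|[x]].
  rewrite subUset !sub1set => /andP[/imsetP[x xB s_x] /imsetP[y yB t_y]].
  have x_neq_y : x != y by apply: contraNneq s_neq_t => xy; rewrite s_x t_y xy.
  exists (x, y); first by rewrite inE xB yB.
  have xy_neq0 : x - y != 0 by rewrite subr_eq0.
  rewrite /f s_x t_y /affine; case: g {g_neq0 s_x t_y} => a b /=.
  by congr (_, _); field.
rewrite inE => /and3P[x1B x2B /fP[fx_neq0 fx1 fx2]] ->.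
by rewrite subUset !sub1set -{1}fx1 -fx2 !imset_f.
Qed.

(** The affine maps whose image of [B] covers the pair are grouped by that image; each group has the
    size of the stabiliser. *)
Lemma card_blocks_through_pair (F : finFieldType) (B S : {set F}) :
    #|S| = 2 ->
  (#|[set C in GA1_blocks B | S \subset C]| * #|affine_stab B|
   = #|B| * (#|B| - 1))%N.
Proof.
move=> /eqP/cards2P[s [t [s_neq_t ->]]].
rewrite -(card_affine_cover_pair B s_neq_t).
set A := [set g : F * F | _].
have -> : [set C in GA1_blocks B | [set s; t] \subset C]
    = [set affine g @: B | g in A].
  apply/setP=> C; rewrite inE GA1_blocksE.
  apply/andP/imsetP=> [[/imsetP[g]]|[g]].
    by rewrite inE => g_neq0 -> st_gB; exists g; rewrite ?inE ?g_neq0.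
  rewrite inE => /andP[g_neq0 st_gB] ->; split=> //.
  by apply/imsetP; exists g; rewrite ?inE.
rewrite -[RHS]sum1_card (partition_big_imset (fun g => affine g @: B)) /=.
rewrite -sum_nat_const; apply: eq_bigr => C /imsetP[g0].
rewrite inE => /andP[g0_neq0 st_g0B] ->.
rewrite -(card_affine_fiber B g0_neq0) -sum1_card; apply: eq_bigl => g.
rewrite !inE; case: (affine g @: B =P _) => [->|_]; last by rewrite !andbF.
by rewrite st_g0B !andbT.
Qed.

(** * Moments and their invariance *)

(* Equals [-4] times the [j]-th power sum of the base block, with
   [c = nsqrt (- tau)] and [d = nsqrt tau], as long as [2 * j < #|F| - 1]. *)
Definition moment (F : fieldType) (c d j : nat) : F :=
  (central_binomial j)%:R / 2%:R ^+ j + (-1) ^+ j * c%:R + d%:R.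

(** Binomial expansion of the power sums of [a * z + b]. The relation is linear in [m], so the
    common factor [-4] does no harm. *)
Definition moment_invariant (F : fieldType) (m : nat -> F) (a b : F)
    (j : nat) :=
  m j = \sum_(i < j.+1) m i * a ^+ i * b ^+ (j - i) *+ 'C(j, i).

(** In the coordinate [z = 2 * y / tau - 1] the map [g] becomes [z |-> g.1 * z + (g.1 + 2 * g.2 /
    tau - 1)]. *)
Lemma affine_stab_moment (F : finFieldType) (tau : F) (g : F * F) (j : nat) :
    2%:R != 0 :> F -> tau != 0 -> (2 * j < #|F|.-1)%N ->
    g \in affine_stab (base_block tau) ->
  moment_invariant (moment F (nsqrt (- tau)) (nsqrt tau))
    g.1 (g.1 + 2%:R * g.2 / tau - 1) j.
Proof.
move=> two_neq0 tau_neq0 j_lt; rewrite inE => /andP[g_neq0 /eqP gB].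
set a := g.1; set b := _ + _ - 1.
pose M i := \sum_(y in base_block tau) (2%:R * y / tau - 1) ^+ i.
have momentE i : (i <= j)%N ->
    moment F (nsqrt (- tau)) (nsqrt tau) i = - (M i * 4%:R).
  by move=> i_le; rewrite power_sum_base_block ?opprK //; lia.
rewrite /moment_invariant momentE //.
have -> : M j = \sum_(i < j.+1) M i * a ^+ i * b ^+ (j - i) *+ 'C(j, i).
  rewrite /M -{1}gB big_imset /=; last by move=> x y _ _; apply: affine_inj.
  rewrite (eq_bigr (fun y => \sum_(i < j.+1)
      (2%:R * y / tau - 1) ^+ i * a ^+ i * b ^+ (j - i) *+ 'C(j, i))).
    rewrite exchange_big /=; apply: eq_bigr => i _.
    by rewrite sumrMnl -!big_distrl.
  move=> y _; rewrite (_ : _ - 1 = b + a * (2%:R * y / tau - 1)).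
    rewrite exprDn; apply: eq_bigr => i _.
    by rewrite exprMn; congr (_ *+ _); ring.
  by rewrite /affine /b /a; field.
rewrite big_distrl -sumrN; apply: eq_bigr => i _.
rewrite momentE; last by rewrite -ltnS ltn_ord.
by rewrite -mulrnAl /=; ring.
Qed.

(** * Solving the moment equations *)

Lemma moment_invariant_upto5 (F : fieldType) (m : nat -> F) (a b : F) :
  [/\ moment_invariant m a b 1%N -> m 1%N = m 0%N * b + m 1%N * a,
      moment_invariant m a b 2%N ->
        m 2%N = m 0%N * b ^+ 2 + 2%:R * m 1%N * a * b + m 2%N * a ^+ 2,
      moment_invariant m a b 3%N ->
        m 3%N = m 0%N * b ^+ 3 + 3%:R * m 1%N * a * b ^+ 2
              + 3%:R * m 2%N * a ^+ 2 * b + m 3%N * a ^+ 3,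
      moment_invariant m a b 4%N ->
        m 4%N = m 0%N * b ^+ 4 + 4%:R * m 1%N * a * b ^+ 3
              + 6%:R * m 2%N * a ^+ 2 * b ^+ 2 + 4%:R * m 3%N * a ^+ 3 * b
              + m 4%N * a ^+ 4
    & moment_invariant m a b 5%N ->
        m 5%N = m 0%N * b ^+ 5 + 5%:R * m 1%N * a * b ^+ 4
              + 10%:R * m 2%N * a ^+ 2 * b ^+ 3
              + 10%:R * m 3%N * a ^+ 3 * b ^+ 2
              + 5%:R * m 4%N * a ^+ 4 * b + m 5%N * a ^+ 5].
Proof.
by split=> inv; rewrite [LHS]inv !big_ord_recr big_ord0 /=;
  rewrite !binS !bin0 !bin0n /=; ring.
Qed.

Lemma moment_invariant_scale (F : fieldType) (m : nat -> F) (a : F) (j : nat) :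
  moment_invariant m a 0 j -> m j * (1 - a ^+ j) = 0.
Proof.
rewrite /moment_invariant big_ord_recr big1 /= => [|i _].
  by rewrite subnn binn expr0 mulr1 add0r mulrBr mulr1 => {1}->; rewrite subrr.
by rewrite expr0n subn_eq0 leqNgt ltn_ord mulr0 mul0rn.
Qed.

(* Up to units, [X2] to [X5] are the scaling conditions on the central moments
   of orders 2 to 5. The variance vanishes in characteristic 7, hence order 4,
   and the third central moment vanishes in characteristic 11, hence order 5. *)
Lemma rigid_3mod4 (F : fieldType) (m : nat -> F) (a b e : F) :
    2%:R != 0 :> F -> (e == 2%:R) || (e == - 2%:R) ->
    m 0%N = 3%:R -> m 1%N = e -> m 2%N * 2%:R = 5%:R -> m 3%N = e ->
    m 4%N * 8%:R = 19%:R -> m 5%N = e ->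
    (forall j, (j <= 5)%N -> moment_invariant m a b j) ->
  a = 1 /\ b = 0.
Proof.
move=> two_neq0 e_pm m0 m1 m2 m3 m4 m5 inv.
have [E1 E2 E3 E4 E5] := moment_invariant_upto5 m a b.
move: {E1 E2 E3 E4 E5} (E1 (inv 1%N isT)) (E2 (inv 2%N isT)) (E3 (inv 3%N isT))
  (E4 (inv 4%N isT)) (E5 (inv 5%N isT)).
have eight_neq0 : 8%:R != 0 :> F.
  by rewrite (_ : 8%:R = 2%:R ^+ 3) ?expf_neq0 //; ring.
rewrite (canRL (mulfK two_neq0) m2) (canRL (mulfK eight_neq0) m4).
rewrite m0 m1 m3 m5 => E1 E2 E3 E4 E5.
have e_neq0 : e != 0 by case/orP: e_pm => /eqP->; rewrite ?oppr_eq0.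
(* In characteristic 3 the moment [m 0] vanishes, so order 1 yields [a] instead of [b], and order 2
   then yields [b]. *)
have [three0|three_neq0] := eqVneq (3%:R : F) 0.
  have a1 : a = 1.
    by apply: (mulfI e_neq0); rewrite mulr1 [RHS]E1 three0 mul0r add0r.
  split=> //; apply: (mulfI (mulf_neq0 two_neq0 e_neq0)).
  rewrite mulr0; move: E2; rewrite a1 three0.
  by move=> /eqP; rewrite -subr_eq0 => /eqP E2; rewrite -[RHS]oppr0 -E2; ring.
have b_def : b = e * (1 - a) / 3%:R.
  by apply: (mulIf three_neq0); rewrite mulfVK // mulrBr mulr1 {1}E1; ring.
suff a1 : a = 1 by rewrite b_def a1 subrr mulr0 mul0r.
have dE (x y : F) : x = y -> x - y = 0 by move=> ->; rewrite subrr.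
(* The multipliers 6, [-9 e], 216 and [-162 e] clear denominators after [b] is substituted; the
   factor [e] in odd orders leaves only [e ^ 2 = 4]. *)
have X2 : 7%:R * (1 - a ^+ 2) = 0.
  rewrite -(mulr0 6%:R) -(dE _ _ E2) b_def.
  by case/orP: e_pm => /eqP->; field; rewrite ?two_neq0 ?three_neq0 ?eight_neq0.
have X3 : 22%:R * (1 - a ^+ 3) - 42%:R * (1 - a ^+ 2) = 0.
  rewrite -(mulr0 (- 9%:R * e)) -(dE _ _ E3) b_def.
  by case/orP: e_pm => /eqP->; field; rewrite ?two_neq0 ?three_neq0 ?eight_neq0.
have X4 : 417%:R * (1 - a ^+ 4) - 704%:R * (1 - a ^+ 3)
          + 672%:R * (1 - a ^+ 2) = 0.
  rewrite -(mulr0 216%:R) -(dE _ _ E4) b_def.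
  by case/orP: e_pm => /eqP->; field; rewrite ?two_neq0 ?three_neq0 ?eight_neq0.
have X5 : 925%:R * (1 - a ^+ 5) - 2085%:R * (1 - a ^+ 4)
          + 1760%:R * (1 - a ^+ 3) - 1120%:R * (1 - a ^+ 2) = 0.
  rewrite -(mulr0 (- 162%:R * e)) -(dE _ _ E5) b_def.
  by case/orP: e_pm => /eqP->; field; rewrite ?two_neq0 ?three_neq0 ?eight_neq0.
(* Modulo 7, [22 = 1] and [2 * 417 = 1], so [X3] and [X4] give [a ^ 3 = a ^ 4 = 1]. *)
have [seven0|seven_neq0] := eqVneq (7%:R : F) 0.
  have a3 : 1 - a ^+ 3 = 0.
    rewrite [LHS](_ : _ = 22%:R * (1 - a ^+ 3) - 42%:R * (1 - a ^+ 2)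
      - 7%:R * (3%:R * (1 - a ^+ 3) - 6%:R * (1 - a ^+ 2))); last by ring.
    by rewrite X3 seven0 mul0r subr0.
  have a4 : 1 - a ^+ 4 = 0.
    rewrite [LHS](_ : _ = 2%:R * (417%:R * (1 - a ^+ 4)
        - 704%:R * (1 - a ^+ 3) + 672%:R * (1 - a ^+ 2))
      + 1408%:R * (1 - a ^+ 3)
      - 7%:R * (119%:R * (1 - a ^+ 4) + 192%:R * (1 - a ^+ 2))); last by ring.
    by rewrite X4 a3 seven0 !(mulr0, mul0r, addr0, subr0).
  apply/esym/eqP; rewrite -subr_eq0.
  rewrite (_ : 1 - a = 1 - a ^+ 4 - a * (1 - a ^+ 3)); last by ring.
  by rewrite a3 a4 mulr0 subr0.
have a2 : 1 - a ^+ 2 = 0.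
  by move/eqP: X2; rewrite mulf_eq0 (negPf seven_neq0) => /eqP.
apply/esym/eqP; rewrite -subr_eq0.
(* Modulo 11, [925 = 1] and [1760 = 0], so [X5] together with [a ^ 2 = 1] gives [a ^ 5 = 1], hence
   [a = 1]. *)
have [eleven0|eleven_neq0] := eqVneq (11%:R : F) 0.
  rewrite (_ : 1 - a = 925%:R * (1 - a ^+ 5) - 2085%:R * (1 - a ^+ 4)
          + 1760%:R * (1 - a ^+ 3) - 1120%:R * (1 - a ^+ 2)
        + ((2085%:R - a) * (1 + a ^+ 2) + 1120%:R) * (1 - a ^+ 2)
        - 11%:R * (84%:R * (1 - a ^+ 5) + 160%:R * (1 - a ^+ 3))); last by ring.
  by rewrite X5 a2 eleven0 !(mulr0, mul0r, addr0, subr0).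
have a3 : 1 - a ^+ 3 = 0.
  move/eqP: X3; rewrite a2 mulr0 subr0 (_ : 22%:R = 2%:R * 11%:R); last by ring.
  by rewrite !mulf_eq0 (negPf two_neq0) (negPf eleven_neq0) => /eqP.
rewrite (_ : 1 - a = 1 - a ^+ 3 - a * (1 - a ^+ 2)); last by ring.
by rewrite a2 a3 mulr0 subr0.
Qed.

Lemma rigid_1mod4_nonsquare (F : fieldType) (m : nat -> F) (a b : F) :
    m 0%N = 1 -> m 1%N = 0 -> m 2%N * 2%:R = 1 ->
    (forall j, (j <= 2)%N -> moment_invariant m a b j) ->
  a ^+ 2 = 1 /\ b = 0.
Proof.
move=> m0 m1 m2 inv; have [E1 _ _ _ _] := moment_invariant_upto5 m a b.
have b0 : b = 0.
  by have := E1 (inv 1%N isT); rewrite m0 m1 mul1r mul0r addr0.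
split=> //; apply/esym/eqP; rewrite -subr_eq0.
have := inv 2%N isT; rewrite b0 => /moment_invariant_scale scale.
by rewrite -[1 - _]mul1r -{1}m2 mulrAC scale mul0r.
Qed.

(* The invariant of order 10 is needed only in characteristic 3, where the
   second moment [9 / 2] vanishes. *)
Lemma rigid_1mod4_square (F : fieldType) (m : nat -> F) (a b : F) :
    2%:R != 0 :> F ->
    m 0%N = 5%:R -> m 1%N = 0 -> m 2%N * 2%:R = 9%:R -> m 3%N = 0 ->
    m 4%N * 8%:R = 35%:R -> m 10%N * 256%:R = 63%:R + 1024%:R ->
    (forall j, (j <= 3)%N -> moment_invariant m a b j) ->
    (3%:R = 0 :> F -> forall j, (j <= 10)%N -> moment_invariant m a b j) ->
  a ^+ 2 = 1 /\ b = 0.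
Proof.
move=> two_neq0 m0 m1 m2 m3 m4 m10 inv inv10.
have [E1 _ E3 _ _] := moment_invariant_upto5 m a b.
have dvd1 j (x : F) : m j * x != 0 -> m j * (1 - a ^+ j) = 0 -> 1 - a ^+ j = 0.
  by rewrite mulf_eq0 negb_or => /andP[mj_neq0 _] /eqP;
    rewrite mulf_eq0 (negPf mj_neq0) => /eqP.
(* In characteristic 5 the moment [m 0] vanishes and order 1 says nothing about [b]; order 2 gives
   [a ^ 2 = 1], and order 3 reduces to [3 * m 2 * b = 0]. *)
have [five0|five_neq0] := eqVneq (5%:R : F) 0.
  have m2_neq0 : m 2%N * 2%:R != 0.
    rewrite m2 (_ : 9%:R = 5%:R + 2%:R * 2%:R); last by ring.
    by rewrite five0 add0r mulf_neq0.
  have three_neq0 : 3%:R != 0 :> F.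
    apply: contra_neq two_neq0 => three0.
    rewrite (_ : 2%:R = 5%:R - 3%:R); last by ring.
    by rewrite five0 three0 subr0.
  have [_ E2 _ _ _] := moment_invariant_upto5 m a b.
  have a2 : 1 - a ^+ 2 = 0.
    apply: (dvd1 _ _ m2_neq0); rewrite mulrBr mulr1 {1}(E2 (inv 2%N isT)).
    by rewrite m0 m1 five0; ring.
  have a2_1 : a ^+ 2 = 1 by apply/esym/eqP; rewrite -subr_eq0 a2.
  split=> //; have := E3 (inv 3%N isT).
  rewrite m0 m1 m3 five0 a2_1 mulr1 !mulr0 !mul0r !add0r addr0.
  move/esym/eqP; rewrite !mulf_eq0 (negPf three_neq0) /=.
  by move: m2_neq0; rewrite mulf_eq0 => /norP[/negPf->] _ /eqP.
have b0 : b = 0.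
  have /esym/eqP := E1 (inv 1%N isT).
  by rewrite m0 m1 mul0r addr0 mulf_eq0 (negPf five_neq0) => /eqP.
split=> //; apply/esym/eqP; rewrite -subr_eq0.
have scale j : moment_invariant m a b j -> m j * (1 - a ^+ j) = 0.
  by rewrite b0; apply: moment_invariant_scale.
have [three0|three_neq0] := eqVneq (3%:R : F) 0; last first.
  apply/eqP/(dvd1 _ 2%:R); last exact/scale/inv.
  by rewrite m2 (_ : 9%:R = 3%:R * 3%:R) ?mulf_neq0 //; ring.
(* The exponents 4 and 10 have greatest common divisor 2. For the base block, order 6 also vanishes
   in characteristic 3, and order 8 adds nothing to order 4. *)
have a4 : 1 - a ^+ 4 = 0.
  apply: (dvd1 _ 8%:R); last by apply/scale/inv10.
  rewrite m4 (_ : 35%:R = 3%:R * 11%:R + 2%:R); last by ring.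
  by rewrite three0 mul0r add0r.
have a10 : 1 - a ^+ 10 = 0.
  apply: (dvd1 _ 256%:R); last by apply/scale/inv10.
  rewrite m10 (_ : _ + _ = 3%:R * 21%:R + 2%:R ^+ 10); last by ring.
  by rewrite three0 mul0r add0r expf_neq0.
rewrite (_ : 1 - a ^+ 2
  = 1 - a ^+ 10 - a ^+ 2 * (1 + a ^+ 4) * (1 - a ^+ 4)); last by ring.
by rewrite a4 a10 mulr0 subr0.
Qed.

(** * The stabiliser of the base block *)

(** Squares are the even powers of a primitive root [g], and [-1] is [g] to the power
    [(#|F| - 1) / 2]. *)
Lemma nzsquares_opp (F : finFieldType) (z : F) :
    odd #|F| -> z != 0 ->
  (- z \in nzsquares F) = (z \in nzsquares F) (+) odd (#|F|.-1)./2.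
Proof.
move=> F_odd z_neq0; have [g g_prim] := ex_prim_root_card F.
have F_gt1 := finNzRing_gt1 F; set N := #|F|.-1 in g_prim *.
have N_gt0 : (0 < N)%N by rewrite -ltnS prednK // ltnW.
have N_even : ~~ odd N by move: F_odd; rewrite -[#|F|]prednK // ltnW.
have g_neq0 : g != 0 by rewrite (prim_root_eq0 g_prim) -lt0n.
have square_exp e : (g ^+ e \in nzsquares F) = ~~ odd e.
  rewrite inE expf_neq0 //=; apply/existsP/idP => [[y /eqP y_sq]|e_even].
    have y_neq0 : y != 0.
      apply: contraTneq (expf_neq0 e g_neq0).
      by rewrite y_sq => ->; rewrite expr0n eqxx.
    have [f y_f] := prim_rootP g_prim (expf_card_pred y_neq0).
    move/eqP: y_sq; rewrite y_f -exprM (eq_prim_root_expr g_prim) => /eqP e_f.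
    have := congr1 odd e_f; rewrite !odd_mod ?(negPf N_even) //.
    by rewrite oddM andbF => ->.
  by exists (g ^+ e./2); rewrite -exprM muln2 even_halfK.
have neg1 : g ^+ N./2 = -1.
  have half : ((g ^+ N./2) ^+ 2 == 1).
    by rewrite -exprM muln2 even_halfK // (prim_expr_order g_prim).
  move: half; rewrite sqrf_eq1 => /orP[|/eqP //].
  rewrite -(expr0 g) (eq_prim_root_expr g_prim) mod0n modn_small; lia.
have [e ->] := prim_rootP g_prim (expf_card_pred z_neq0).
by rewrite -mulN1r -neg1 -exprD !square_exp oddD addbC -addNb.
Qed.

(** The hyperbola sum with weight 1 in [nat]: the power sum of order 0 would give the size only
    modulo the characteristic. *)
Lemma card_base_block (F : finFieldType) (tau : F) :
    2%:R != 0 :> F -> tau != 0 ->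
  (#|base_block tau| * 4 + nsqrt (- tau) + nsqrt tau = #|F|.-1)%N.
Proof.
move=> two_neq0 tau_neq0.
have := sum_base_block (fun=> 1%N) two_neq0 tau_neq0.
rewrite [X in _ = X -> _](_ : _ = #|F|.-1); last first.
  by rewrite -(cardsC1 (0 : F)) -sum1_card; apply: eq_bigl => x; rewrite !inE.
rewrite sum1_card => <-; lia.
Qed.

Lemma id_affine_stab (F : finFieldType) (B : {set F}) :
  (1, 0) \in affine_stab B.
Proof.
rewrite inE oner_neq0 /= -{2}(imset_id B); apply/eqP/eq_imset => x.
by rewrite /affine mul1r addr0.
Qed.

Lemma nsqrt_values (F : finFieldType) (tau : F) :
    2%:R != 0 :> F -> odd #|F| -> tau != 0 ->
  [/\ (#|F| %% 4 = 3)%N -> (nsqrt (- tau) = 2 * (tau \notin nzsquares F))%N,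
      (#|F| %% 4 = 1)%N -> (nsqrt (- tau) = 2 * (tau \in nzsquares F))%N
    & (nsqrt tau = 2 * (tau \in nzsquares F))%N].
Proof.
move=> two_neq0 F_odd tau_neq0.
split=> [F_mod|F_mod|]; rewrite nsqrt_nzsquare ?oppr_eq0 // mulnC //.
  rewrite nzsquares_opp // (_ : odd _ = true) ?addbT //.
  by apply/idP; lia.
rewrite nzsquares_opp // (_ : odd _ = false) ?addbF //.
by apply/negP; lia.
Qed.

Lemma moment_values (F : fieldType) (c d : nat) : 2%:R != 0 :> F ->
  [/\ moment F c d 0 = 1 + c%:R + d%:R,
      moment F c d 2 * 2%:R = 1 + 2%:R * (c%:R + d%:R),
      moment F c d 4 * 8%:R = 3%:R + 8%:R * (c%:R + d%:R),
      moment F c d 10 * 256%:R = 63%:R + 256%:R * (c%:R + d%:R)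
    & forall j, odd j -> moment F c d j = d%:R - c%:R].
Proof.
move=> two_neq0; rewrite /moment /central_binomial.
have two_pow i : (2 ^ i)%:R != 0 :> F by rewrite natrX expf_neq0.
have C2 : 'C(2, 2./2) = 2%N by [].
have C4 : 'C(4, 4./2) = 6%N by [].
have C10 : 'C(10, 10./2) = 252%N by rewrite /= !binS !bin0 !bin0n.
split=> [||||j j_odd].
- by rewrite /= bin0 divr1 mul1r.
- by rewrite C2 /=; field; exact: (two_pow 2%N).
- by rewrite C4 /=; field; exact: (two_pow 4%N).
- by rewrite C10 /=; field; exact: (two_pow 10%N).
by rewrite -signr_odd j_odd mul0r add0r expr1 mulN1r addrC.
Qed.

(** Exactly one of [tau] and [- tau] is a square, so the root counts are 0 and 2 in some order and
    [e] is 2 or [-2]. Order 5 requires [10 < #|F| - 1]. *)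
Lemma affine_stab_3mod4 (F : finFieldType) (tau : F) :
    2%:R != 0 :> F -> tau != 0 -> (#|F| %% 4 = 3)%N -> (11 < #|F|)%N ->
  affine_stab (base_block tau) = [set (1, 0)].
Proof.
move=> two_neq0 tau_neq0 F_mod F_gt; apply/eqP; rewrite eqEsubset sub1set.
rewrite id_affine_stab andbT; apply/subsetP => g g_stab; rewrite inE.
have F_odd : odd #|F| by lia.
have inv j : (j <= 5)%N ->
    moment_invariant (moment F (nsqrt (- tau)) (nsqrt tau))
      g.1 (g.1 + 2%:R * g.2 / tau - 1) j.
  by move=> j_le; apply: affine_stab_moment => //; lia.
have [/(_ F_mod) N1 _ N2] := nsqrt_values two_neq0 F_odd tau_neq0.
pose e : F := (nsqrt tau)%:R - (nsqrt (- tau))%:R.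
have [] : g.1 = 1 /\ g.1 + 2%:R * g.2 / tau - 1 = 0.
  have [v0 v2 v4 _ v_odd] :=
    moment_values (nsqrt (- tau)) (nsqrt tau) two_neq0.
  apply: (rigid_3mod4 (e := e) two_neq0 _ _ _ _ _ _ _ inv);
    rewrite ?v0 ?v2 ?v4 ?v_odd // /e ?N1 ?N2.
  - by case: (tau \in _); rewrite ?subr0 ?sub0r eqxx ?orbT.
  - by case: (tau \in _) => /=; ring.
  - by case: (tau \in _) => /=; ring.
  - by case: (tau \in _) => /=; ring.
case: g {g_stab inv} => a b /= -> /eqP.
rewrite addrAC subrr add0r !mulf_eq0 invr_eq0 (negPf two_neq0) (negPf tau_neq0).
by rewrite orbF => /eqP->.
Qed.

(** The map [y |-> tau - y] exchanges [y] and [y - tau] up to sign, and [-1] is a square. *)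
Lemma reflection_affine_stab (F : finFieldType) (tau : F) :
    odd #|F| -> (#|F| %% 4 = 1)%N ->
  (-1, tau) \in affine_stab (base_block tau).
Proof.
move=> F_odd F_mod; rewrite inE oppr_eq0 oner_neq0 eqEcard /=.
rewrite card_imset ?leqnn ?andbT; last first.
  by apply: affine_inj; rewrite oppr_eq0 oner_neq0.
have opp_sq (z : F) : z \in nzsquares F -> - z \in nzsquares F.
  move=> z_sq; have z_neq0 : z != 0 by move: z_sq; rewrite inE => /andP[].
  rewrite nzsquares_opp // z_sq (_ : odd _ = false) //.
  by apply/negP; lia.
apply/subsetP => _ /imsetP[y + ->]; rewrite !in_base_block /affine /=.
move=> /andP[y_sq y_tau_sq]; rewrite mulN1r addrK (opp_sq y) // andbT.
by rewrite addrC -opprB opp_sq.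
Qed.

(** Now [tau] and [- tau] have equally many roots, so odd moments vanish. The bounds 5, 9 and 21
    make orders 2, 3 and 10 available. *)
Lemma affine_stab_1mod4 (F : finFieldType) (tau : F) :
    2%:R != 0 :> F -> tau != 0 -> (#|F| %% 4 = 1)%N -> (5 < #|F|)%N ->
    (tau \in nzsquares F -> (9 < #|F|)%N) ->
    (tau \in nzsquares F -> 3%:R = 0 :> F -> (21 < #|F|)%N) ->
  affine_stab (base_block tau) = [set (1, 0); (-1, tau)].
Proof.
move=> two_neq0 tau_neq0 F_mod F_gt5 F_gt9 F_gt21.
have F_odd : odd #|F| by lia.
apply/eqP; rewrite eqEsubset subUset !sub1set.
rewrite id_affine_stab reflection_affine_stab // !andbT.
apply/subsetP => g g_stab.
have inv j : (2 * j < #|F|.-1)%N ->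
    moment_invariant (moment F (nsqrt (- tau)) (nsqrt tau))
      g.1 (g.1 + 2%:R * g.2 / tau - 1) j.
  by move=> j_lt; apply: affine_stab_moment.
have lt_pred j r : (2 * j < r)%N -> (r < #|F|)%N -> (2 * j < #|F|.-1)%N by lia.
have [_ /(_ F_mod) N1 N2] := nsqrt_values two_neq0 F_odd tau_neq0.
have [] : g.1 ^+ 2 = 1 /\ g.1 + 2%:R * g.2 / tau - 1 = 0.
  have [v0 v2 v4 v10 v_odd] :=
    moment_values (nsqrt (- tau)) (nsqrt tau) two_neq0.
  move: N1 N2 F_gt9 F_gt21; case: (_ \in _) => /= N1 N2 F_gt9 F_gt21.
    apply: (rigid_1mod4_square two_neq0) => [||||||j j_le|three0 j j_le];
      [ | | | | | | by apply/inv/(lt_pred _ _ _ (F_gt9 isT)); lia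
      | by apply/inv/(lt_pred _ _ _ (F_gt21 isT three0)); lia];
      rewrite ?v0 ?v2 ?v4 ?v10 ?v_odd // ?N1 ?N2.
    - by ring.
    - by ring.
    - by ring.
    - by ring.
    - by ring.
    - by ring.
  apply: rigid_1mod4_nonsquare => [|||j j_le];
    [ | | | by apply/inv/(lt_pred _ _ _ F_gt5); lia];
    rewrite ?v0 ?v2 ?v_odd // ?N1 ?N2.
  - by ring.
  - by ring.
  - by ring.
case: g {g_stab inv} => a b /= /eqP; rewrite sqrf_eq1 !inE.
have two_tau : 2%:R / tau != 0 by rewrite mulf_neq0 ?invr_eq0.
case/orP=> /eqP-> b_eq; apply/orP; [left|right]; apply/eqP; congr (_, _).
  by apply: (mulfI two_tau); rewrite mulr0 -b_eq; ring.
apply: (mulfI two_tau); apply/eqP; rewrite -subr_eq0 -b_eq; apply/eqP.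
by field.
Qed.

(** * Parameters of the design *)

(* The hypothesis [q <> 11] is necessary. For q = 11 and tau = 1 the base block
   is {4, 5}, its orbit is the set of all 55 pairs, and every pair lies in
   exactly 1 block, whereas k * (k - 1) = 2. *)
Theorem theorem9 (p n q : nat) (p_prime : prime p) (p_odd : odd p)
    (n_gt0 : (0 < n)%N) (q_def : q = (p ^ n)%N) (q_neq11 : q <> 11%N)
    (F : finFieldType) (card_F : #|F| = q)
    (tau : F) (tau_neq0 : tau != 0)
    (k lambda : nat)
    (k_3mod4 : (q = 3 %[mod 4])%N -> k = ((q - 3) %/ 4)%N)
    (k_1mod4_square : (q = 1 %[mod 4])%N -> tau \in nzsquares F ->
       k = ((q - 5) %/ 4)%N)
    (k_1mod4_nonsquare : (q = 1 %[mod 4])%N -> tau \in nonsquares F ->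
       k = ((q - 1) %/ 4)%N)
    (lambda_3mod4 : (q = 3 %[mod 4])%N -> lambda = (k * (k - 1))%N)
    (lambda_1mod4 : (q = 1 %[mod 4])%N -> lambda = (k * (k - 1) %/ 2)%N) :
  is_design 2 q k lambda (GA1_blocks (base_block tau)).
Proof.
have p_char : p \in [pchar F].
  by apply: (card_finPcharP (n := n)); rewrite ?card_F.
have q_odd : odd q by rewrite q_def oddX p_odd orbT.
have F_odd : odd #|F| by rewrite card_F.
have two_neq0 : 2%:R != 0 :> F.
  rewrite -(dvdn_pcharf p_char) dvdn_prime2 //.
  by apply: contraTneq p_odd => ->.
have [N1_3 N1_1 N2] := nsqrt_values two_neq0 F_odd tau_neq0.
have := card_base_block two_neq0 tau_neq0.
have := @card_blocks_through_pair F (base_block tau).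
set B := base_block tau => count_blocks.
rewrite N2 card_F in N1_3 N1_1 * => card_B.
have tau_nonsquare : tau \notin nzsquares F -> tau \in nonsquares F.
  by rewrite !inE tau_neq0.
have q_mod : (q %% 4 = 3 \/ q %% 4 = 1)%N by clear - q_odd; lia.
have k_def : k = #|B|.
  case: q_mod => q_mod.
    rewrite k_3mod4 //; move: card_B; rewrite N1_3 // -addnA -mulnDr.
    by case: (tau \in _) => /= card_B; clear - q_mod card_B; lia.
  move: card_B; rewrite N1_1 //.
  case: (boolP (tau \in _)) => [tau_sq|/tau_nonsquare tau_nsq] /= card_B.
    by rewrite k_1mod4_square //; clear - q_mod card_B; lia.
  by rewrite k_1mod4_nonsquare //; clear - q_mod card_B; lia.
have lambda_def : lambda = (k * (k - 1) %/ (if q %% 4 == 3 then 1 else 2))%N.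
  case: q_mod => q_mod; rewrite q_mod /=; first by rewrite divn1 lambda_3mod4.
  by rewrite lambda_1mod4.
(* This turns [1 < k] into the lower bounds on [q] required by the stabiliser lemmas. *)
have k_q : (if q %% 4 == 3 then k * 4 + 2 = q.-1
            else k * 4 + 4 * (tau \in nzsquares F) = q.-1)%N.
  rewrite k_def -card_B; case: q_mod => q_mod; rewrite q_mod /=.
    by rewrite N1_3 // -addnA -mulnDr; case: (tau \in _).
  by rewrite N1_1 // -addnA -mulnDl.
clear k_3mod4 k_1mod4_square k_1mod4_nonsquare lambda_3mod4 lambda_1mod4.
clear N1_3 N1_1 N2.
rewrite -k_def in count_blocks card_B *.
split=> // [b /card_GA1_block->//|S S_card].
have := count_blocks S S_card; set r := #|[set _ in _ | _]| => count.
have stab_gt0 : (0 < #|affine_stab B|)%N.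
  by rewrite card_gt0; apply/set0Pn; exists (1, 0); apply: id_affine_stab.
(* For the smallest fields the stabiliser may be larger, but blocks with at most one point cover no
   pair and both counts are 0. *)
have [k_le1|k_gt1] := leqP k 1.
  have k_pred0 : (k * (k - 1) = 0)%N by clear - k_le1; case: k k_le1 => [|[]].
  rewrite lambda_def k_pred0 div0n.
  move/eqP: count; rewrite k_pred0 muln_eq0 orbC.
  by rewrite (gtn_eqF stab_gt0) => /eqP.
case: q_mod => q_mod; rewrite q_mod /= in lambda_def k_q.
  rewrite lambda_def divn1 -count affine_stab_3mod4 ?cards1 ?muln1 ?card_F //.
  by clear - q_mod k_q k_gt1 q_neq11; lia.
have neg1 : 1 != -1 :> F by rewrite -subr_eq0 opprK -mulr2n.
rewrite lambda_def -count affine_stab_1mod4 ?card_F //.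
- rewrite cards2 (_ : (1, 0) != (-1, tau)) ?mulnK //.
  by apply: contraNneq neg1 => -[{1}-> _].
- by clear - q_mod k_q k_gt1; case: (tau \in _) k_q => /=; lia.
- by move=> tau_sq; rewrite tau_sq in k_q; clear - k_q k_gt1; lia.
(* A power of 3 above 9 is at least 27, which exceeds the bound 21. *)
move=> tau_sq three0.
have p3 : p = 3%N.
  apply/eqP; rewrite -dvdn_prime2 //.
  by rewrite (dvdn_pcharf p_char) three0.
have q_gt9 : (9 < q)%N.
  by rewrite tau_sq in k_q; clear - k_q k_gt1; lia.
rewrite q_def p3 in q_gt9 *.
have n_gt2 : (2 < n)%N by rewrite -(ltn_exp2l 2 n (isT : (1 < 3)%N)).
by apply: (@leq_trans (3 ^ 3)); rewrite // leq_exp2l.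
Qed.
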